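(* Let $a,b$ be positive integers with $b\ge2$ and $\gcd(a,b)=1$. Then every $t\in\{1,\dots,b\}$ at which $S_{(a,1;b)}(t)$ attains its maximum over $1\le t\le b$ lies in the interval $\left[\frac{b+1}{2},\frac{b+1}{2}+a\right]$, and every $t\in\{1,\dots,b\}$ at which $S_{(a,1;b)}(t)$ attains its minimum over $1\le t\le b$ lies in the interval $\left[1,\min\{a,\frac{b+1}{2}\}\right]$.
   Context: $\xi_b=e^{2\pi i/b}$ and $S_{(a,1;b)}(n)=\frac1b\sum_{j=1}^{b-1}\frac{\xi_b^{jn}}{(1-\xi_b^{ja})(1-\xi_b^{j})}$. *)

(* Defs.v *)
From HB Require Import structures.
From mathcomp Require Import all_boot all_order all_algebra.
From mathcomp Require Import complex.
From mathcomp Require Import reals trigo.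

Set Implicit Arguments.
Unset Strict Implicit.
Unset Printing Implicit Defensive.

Import Order.TTheory GRing.Theory Num.Theory.

Local Open Scope ring_scope.
Local Open Scope complex_scope.

(* e^(2 i pi / b), written through Euler's formula. *)
Definition xi (R : realType) (b : nat) : R[i] :=
  cos (2 * pi / b%:R) +i* sin (2 * pi / b%:R).

Definition fourier_dedekind (R : realType) (a b n : nat) : R[i] :=
  b%:R^-1 * \sum_(1 <= j < b)
    xi R b ^+ (j * n) / ((1 - xi R b ^+ (j * a)) * (1 - xi R b ^+ j)).

Lemma xi_conj (R : realType) (b : nat) : Num.conj (xi R b) = (xi R b)^-1.
Proof.
have h : xi R b * Num.conj (xi R b) = 1.
  apply/eqP; rewrite eq_complex /= mulrN opprK -!expr2 cos2Dsin2 eqxx /=.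
  by rewrite mulrN mulrC addNr.
have nz : xi R b != 0.
  by apply: contra_eq_neq h => ->; rewrite mul0r eq_sym oner_eq0.
by apply: (mulfI nz); rewrite h mulfV.
Qed.

Lemma xi_expb (R : realType) (b : nat) : (0 < b)%N -> xi R b ^+ b = 1.
Proof.
move=> b0.
have moivre k (x : R) : (cos x +i* sin x) ^+ k = cos (k%:R * x) +i* sin (k%:R * x).
  elim: k => [|k IHk]; first by rewrite expr0 mul0r cos0 sin0.
  rewrite exprS IHk -natr1 mulrDl mul1r.
  by apply/eqP; rewrite eq_complex /= ![_ + x]addrC cosD sinD eqxx addrC eqxx.
rewrite /xi moivre mulrC divfK ?pnatr_eq0 -?lt0n //.
by rewrite mulr_natl cos2pi sin2pi.
Qed.

(* In R[i], [x <= y] means that [y - x] is a nonnegative real. As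
   [fourier_dedekind] is real-valued, this order is the usual one on its
   values. *)
Lemma fourier_dedekind_real (R : realType) (a b n : nat) :
  (0 < b)%N -> fourier_dedekind R a b n \is Num.real.
Proof.
move=> b0; apply/Num.Theory.CrealP.
rewrite /fourier_dedekind rmorphM /= fmorphV rmorph_nat; congr (_ * _).
rewrite rmorph_sum /= [in RHS]big_nat_rev /= !big_nat; apply: eq_bigr => j /andP[j1 jb].
have xiU : xi R b != 0.
  by apply: contra_eq_neq (xi_expb R b0) => ->;
    rewrite expr0n eqn0Ngt b0 eq_sym oner_eq0.
have E k : (xi R b)^-1 ^+ (j * k) = xi R b ^+ ((1 + b - j.+1) * k).
  rewrite add1n subSS -[LHS]mul1r -(expr1n _ k) -(xi_expb R b0).
  by rewrite -!exprM mulnBl exprVn expfB_cond // (negPf xiU) leq_mul2r ltnW ?orbT.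
have conjX k : Num.conj (xi R b ^+ k) = (xi R b)^-1 ^+ k by rewrite rmorphXn /= xi_conj.
rewrite rmorphM /= fmorphV rmorphM !rmorphB !rmorph1 /= !conjX.
rewrite !E. by have /= := E 1%N; rewrite !muln1 => ->.
Qed.

(* Main.v *)
(** The idea: [S(n) - S(n+a)] loses the factor [1 - xi^(ja)] and becomes the
    sawtooth [(n - (b+1)/2) / b] for [1 <= n <= b].  At an extremum [t],
    comparing [S(t)] with [S(t+a)] fixes the side of [(b+1)/2] on which [t]
    lies, and comparing it with [S(t-a)], when [t > a], fixes the side on which
    [t - a] lies. *)
Require Import Defs.
From mathcomp Require Import all_boot all_order all_algebra.
From mathcomp Require Import complex.
From mathcomp Require Import reals trigo.
From mathcomp Require Import zify ring lra.

Set Implicit Arguments.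
Unset Strict Implicit.
Unset Printing Implicit Defensive.

Import Order.TTheory GRing.Theory Num.Theory.

Local Open Scope ring_scope.

Section PrimitiveRoot.

Variables (F : fieldType) (b : nat) (z : F).
Hypothesis zP : b.-primitive_root z.

Lemma sum_prim_root_exp (n : nat) :
  ~~ (b %| n)%N -> \sum_(1 <= j < b) z ^+ (j * n) = -1.
Proof.
move=> ndvd; have b0 := prim_order_gt0 zP.
have zn1 : z ^+ n - 1 != 0 by rewrite subr_eq0 -(prim_order_dvd zP).
have : \sum_(0 <= j < b) z ^+ (j * n) = 0.
  apply: (mulfI zn1); rewrite mulr0 big_mkord.
  under eq_bigr => j _ do rewrite mulnC exprM.
  by rewrite -subrX1 -exprM mulnC exprM (prim_expr_order zP) expr1n subrr.
rewrite big_ltn // mul0n expr0 => h.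
by apply/eqP; rewrite -addr_eq0 addrC h.
Qed.

Lemma sub1_prim_root_neq0 (j : nat) : (1 <= j < b)%N -> 1 - z ^+ j != 0.
Proof.
case/andP=> j1 jb; rewrite subr_eq0 eq_sym -(prim_order_dvd zP).
by rewrite gtnNdvd.
Qed.

(** At [z = xi R b] this is [b] times the one-parameter Fourier-Dedekind sum, kept unnormalised so
    that it makes sense in any field with a primitive root. *)
Definition sawtooth (n : nat) : F :=
  \sum_(1 <= j < b) z ^+ (j * n) / (1 - z ^+ j).

(** The numerators of consecutive terms differ by $z^{jn}(1-z^j)$, which cancels the denominator and
    leaves the punctured geometric sum, equal to $-1$. *)
Lemma sawtoothS (n : nat) :
  ~~ (b %| n)%N -> sawtooth n.+1 = sawtooth n + 1.
Proof.
move=> ndvd; apply/eqP; rewrite addrC -subr_eq -opprB; apply/eqP.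
rewrite -[RHS]opprK -(sum_prim_root_exp ndvd) -sumrB; congr (- _).
apply: eq_big_nat => j /sub1_prim_root_neq0 nz.
by rewrite mulnS exprD; field.
Qed.

(* Reindexing [j -> b - j] exchanges the two sums up to sign. *)
Lemma sawtooth1_oppr : sawtooth 1 = - sawtooth b.
Proof.
rewrite /sawtooth big_nat_rev /= -sumrN; apply: eq_big_nat => j jb.
have nz := sub1_prim_root_neq0 jb; case/andP: jb => j1 jb.
have nzj : z ^+ j != 0.
  apply: expf_neq0; apply: contra_eq_neq (prim_expr_order zP) => ->.
  by rewrite expr0n eqn0Ngt (prim_order_gt0 zP) eq_sym oner_eq0.
have -> : z ^+ (j * b) = 1.
  by rewrite mulnC exprM (prim_expr_order zP) expr1n.
rewrite muln1 add1n subSS.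
have -> : z ^+ (b - j) = (z ^+ j)^-1.
  by apply: (mulIf nzj); rewrite -exprD subnK 1?ltnW // mulVf //
    (prim_expr_order zP).
have nz' : z ^+ j - 1 != 0 by rewrite -oppr_eq0 opprB.
by field; rewrite nz nzj nz'.
Qed.

(** [sawtoothS] gives slope 1 on the whole range, since no step starts at a multiple of [b]; the
    antisymmetry of the endpoint values then fixes the constant. Doubling avoids a division by 2. *)
Lemma sawtoothE (n : nat) :
  (1 <= n <= b)%N -> sawtooth n *+ 2 = (n.*2)%:R - b.+1%:R.
Proof.
have lin k : (k < b)%N -> sawtooth k.+1 = sawtooth 1 + k%:R.
  elim: k => [|k IHk] kb; first by rewrite addr0.
  by rewrite sawtoothS ?gtnNdvd // IHk 1?ltnW // -natr1 addrA.
have b0 := prim_order_gt0 zP.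
have := sawtooth1_oppr; have -> : sawtooth b = sawtooth 1 + b%:R - 1.
  by rewrite -{1}(prednK b0) lin ?prednK // -{2}(prednK b0) -natr1; ring.
move=> g1; case: n => // k /andP[_ kb]; rewrite lin // mulrnDl.
have -> : sawtooth 1 *+ 2 = 1 - b%:R by rewrite mulr2n {1}g1; ring.
by rewrite -muln2 natrM -!natr1; ring.
Qed.

End PrimitiveRoot.

Lemma xi_exp (R : realType) (b k : nat) :
  xi R b ^+ k
  = (cos (k%:R * (2 * pi / b%:R)) +i* sin (k%:R * (2 * pi / b%:R)))%C.
Proof.
rewrite /xi; set x := 2 * pi / _; elim: k => [|k IHk]; first by rewrite expr0 mul0r cos0 sin0.
rewrite exprS IHk -natr1 mulrDl mul1r.
by apply/eqP; rewrite eq_complex /= ![_ + x]addrC cosD sinD eqxx addrC eqxx.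
Qed.

Lemma xi_primitive (R : realType) (b : nat) :
  (0 < b)%N -> b.-primitive_root (xi R b).
Proof.
move=> b0; have [m mP mb] := prim_order_exists b0 (xi_expb R b0).
(* If the order [m] were below [b], then $x=\pi m/b$ would lie in $(0,\pi)$, where $\sin x>0$, while
   $\cos 2x=1$ forces $\sin x=0$. *)
have := dvdn_leq b0 mb; rewrite leq_eqVlt => /predU1P[{1}<- //|ltmb].
have m0 := prim_order_gt0 mP.
have := prim_expr_order mP; rewrite xi_exp => -[].
set x : R := pi * (m%:R / b%:R).
have -> : m%:R * (2 * pi / b%:R) = x *+ 2 by rewrite /x -mulr_natl; ring.
have b0R : 0 < b%:R :> R by rewrite ltr0n.
have : 0 < sin x.
  apply: sin_gt0_pi; rewrite /x mulr_gt0 ?pi_gt0 ?divr_gt0 ?ltr0n //=.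
  by rewrite -[ltRHS]mulr1 ltr_pM2l ?pi_gt0 // ltr_pdivrMr // mul1r ltr_nat.
by rewrite cos_mulr2n; have := cos2Dsin2 x; nra.
Qed.

Lemma fourier_dedekind_modn (R : realType) (a b n : nat) : (0 < b)%N ->
  fourier_dedekind R a b (n %% b) = fourier_dedekind R a b n.
Proof.
move=> b0; congr (_ * _); apply: eq_bigr => j _; congr (_ / _).
by rewrite ![(j * _)%N]mulnC !exprM (prim_expr_mod (xi_primitive R b0)).
Qed.

(** The index [t + a] may exceed [b], so an extremality hypothesis reaches it only through
    periodicity; the residue 0 is represented by [b]. *)
Lemma fourier_dedekind_rep (R : realType) (a b n : nat) : (0 < b)%N ->
  exists2 s, (1 <= s <= b)%N & fourier_dedekind R a b s = fourier_dedekind R a b n.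
Proof.
move=> b0; have [n0|n0] := posnP (n %% b).
  by exists b; rewrite ?b0 /= // -fourier_dedekind_modn // modnn -n0
    fourier_dedekind_modn.
by exists (n %% b)%N; rewrite ?n0 /= ?fourier_dedekind_modn // ltnW ?ltn_pmod.
Qed.

Lemma fourier_dedekind_diff (R : realType) (a b n : nat) :
  (0 < b)%N -> coprime a b ->
  fourier_dedekind R a b n - fourier_dedekind R a b (n + a)
  = b%:R^-1 * sawtooth b (xi R b) n.
Proof.
move=> b0 ab; have xiP := xi_primitive R b0.
rewrite -mulrBr -sumrB; congr (_ * _); apply: eq_big_nat => j jb.
have nz := sub1_prim_root_neq0 xiP jb; case/andP: jb => j1 jb.
(* By coprimality, $b\mid ja$ would give $b\mid j$. *)
have nza : 1 - xi R b ^+ (j * a) != 0.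
  rewrite subr_eq0 eq_sym -(prim_order_dvd xiP) Gauss_dvdl 1?coprime_sym //.
  by rewrite gtnNdvd.
by rewrite mulnDr exprD; field; rewrite nz nza.
Qed.

(** Scaling by the positive $2b$ leaves a difference of natural numbers, so comparisons in the
    partial order of [R[i]] become comparisons in [nat]. *)
Lemma fourier_dedekind_diff2 (R : realType) (a b n : nat) :
  coprime a b -> (1 <= n <= b)%N ->
  (fourier_dedekind R a b n - fourier_dedekind R a b (n + a)) * (b.*2)%:R
  = (n.*2)%:R - b.+1%:R.
Proof.
move=> ab nb; have b0 : (0 < b)%N by case/andP: nb; exact: leq_trans.
rewrite fourier_dedekind_diff // -(sawtoothE (xi_primitive R b0) nb).
have bnz : b%:R != 0 :> R[i]%C by rewrite pnatr_eq0 -lt0n.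
by rewrite -muln2 natrM -mulr_natr; field.
Qed.

Lemma fourier_dedekind_le (R : realType) (a b n : nat) :
  coprime a b -> (1 <= n <= b)%N ->
  (fourier_dedekind R a b (n + a) <= fourier_dedekind R a b n)
  = (b.+1 <= n.*2)%N.
Proof.
move=> ab nb; have b0 : (0 < b)%N by case/andP: nb; exact: leq_trans.
rewrite -(ler_nat R[i]%C) -[RHS]subr_ge0 -(fourier_dedekind_diff2 R ab nb).
by rewrite pmulr_lge0 ?subr_ge0 // ltr0n double_gt0.
Qed.

Lemma fourier_dedekind_ge (R : realType) (a b n : nat) :
  coprime a b -> (1 <= n <= b)%N ->
  (fourier_dedekind R a b n <= fourier_dedekind R a b (n + a))
  = (n.*2 <= b.+1)%N.
Proof.
move=> ab nb; have b0 : (0 < b)%N by case/andP: nb; exact: leq_trans.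
rewrite -(ler_nat R[i]%C) -[RHS]subr_le0 -(fourier_dedekind_diff2 R ab nb).
by rewrite pmulr_lle0 ?subr_le0 // ltr0n double_gt0.
Qed.

Theorem theorem32 (R : realType) (a b : nat)
    (ha : (1 <= a)%N) (hb : (2 <= b)%N) (hab : gcdn a b = 1%N) :
  (forall t : nat, (1 <= t <= b)%N ->
     (forall s : nat, (1 <= s <= b)%N ->
        fourier_dedekind R a b s <= fourier_dedekind R a b t) ->
     (b%:R + 1) / 2 <= t%:R :> R /\ t%:R <= (b%:R + 1) / 2 + a%:R :> R) /\
  (forall t : nat, (1 <= t <= b)%N ->
     (forall s : nat, (1 <= s <= b)%N ->
        fourier_dedekind R a b t <= fourier_dedekind R a b s) ->
     1 <= t%:R :> R /\ t%:R <= Num.min a%:R ((b%:R + 1) / 2) :> R).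
Proof.
have b0 : (0 < b)%N by exact: ltnW.
have ab : coprime a b by apply/eqP.
have half_le n : (b.+1 <= n.*2)%N -> (b%:R + 1) / 2 <= n%:R :> R.
  by rewrite -(ler_nat R) -natr1 -muln2 natrM => ?; lra.
have le_half n : (n.*2 <= b.+1)%N -> n%:R <= (b%:R + 1) / 2 :> R.
  by rewrite -(ler_nat R) -natr1 -muln2 natrM => ?; lra.
have pos_half : 0 <= (b%:R + 1) / 2 :> R by apply: (le_half 0%N).
split=> t tb ext; have [s sb sE] := fourier_dedekind_rep R a (t + a) b0;
  have := ext s sb; rewrite sE.
- rewrite fourier_dedekind_le // => /half_le tge; split=> //.
  (* For [t <= a] the upper bound only needs $(b+1)/2\ge 0$. Otherwise [t - a] is an admissible
     index, and its value is at most the one at [t = (t - a) + a]. *)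
  have [ta|ta] := leqP t a.
    by rewrite -(ler_nat R) in ta; lra.
  have ub : (1 <= t - a <= b)%N by lia.
  have := ext _ ub; rewrite -{2}(subnK (ltnW ta)) fourier_dedekind_ge //.
  by move=> /le_half; rewrite natrB ?(ltnW ta) // lerBlDr.
- rewrite fourier_dedekind_ge // => tle; split; first by rewrite ler1n; lia.
  (* If [a < t], minimality against [t - a] gives $2(t-a)\ge b+1$, contradicting $2t\le b+1$ because
     $a\ge 1$. *)
  rewrite le_min le_half // andbT ler_nat leqNgt; apply/negP => ta.
  have ub : (1 <= t - a <= b)%N by lia.
  have := ext _ ub; rewrite -{1}(subnK (ltnW ta)) fourier_dedekind_le //.
  by lia.
Qed.
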